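(* Let $k,p\ge 2$ be integers with $(k,p)\ne(2,2)$, let $2\le a_2\le\dots\le a_p$ be integers, and let $n\ge k+1$ be an integer. Then $$r(K_p(1,a_2,\dots,a_p),B_{k,n})\neq (p-1)(n-1)+d_k(n,K_{1,a_2})+1.$$
   Context: For graphs $H_1,H_2$, the Ramsey number $r(H_1,H_2)$ is the smallest positive integer $N$ such that for every graph $G$ on $N$ vertices, either $G$ contains $H_1$ as a (not necessarily induced) subgraph or the complement $\overline{G}$ contains $H_2$ as a subgraph. $K_p(a_1,\dots,a_p)$ is the complete $p$-partite graph with parts of sizes $a_1,\dots,a_p$, and $K_{1,a_2}$ is the star with $a_2$ leaves. $B_{k,n}$ is the book graph on $n$ vertices consisting of $n-k$ copies of $K_{k+1}$ all sharing a common $K_k$ (i.e. a clique on $k$ vertices together with $n-k$ further vertices, pairwise non-adjacent, each adjacent to all $k$ vertices of the clique). For a graph $H$ and integers $k,n$, $d_k(n,H)$ is the maximum integer $d$ for which there is an $(n+d-1)$-vertex graph that contains no copy of $H$ as a subgraph and in which at most $k-1$ vertices have degree less than $d$. *)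

(* Defs.v *)
From mathcomp Require Import all_boot.
From mathcomp Require Import boolp.
From mathcomp Require classical_sets.
From mathcomp Require Import zify.

Set Implicit Arguments.
Unset Strict Implicit.
Unset Printing Implicit Defensive.

Record sgraph := SGraph {
  vertex :> finType;
  adj : rel vertex;
  adj_sym : symmetric adj;
  adj_irr : irreflexive adj }.

Arguments adj {s} : rename.

Lemma compl_sym (G : sgraph) :
  symmetric (fun x y : G => (x != y) && ~~ adj x y).
Proof. by move=> x y; rewrite eq_sym adj_sym. Qed.

Lemma compl_irr (G : sgraph) :
  irreflexive (fun x y : G => (x != y) && ~~ adj x y).
Proof. by move=> x; rewrite eqxx. Qed.

Definition compl (G : sgraph) : sgraph :=
  SGraph (@compl_sym G) (@compl_irr G).

(* G contains H as a (not necessarily induced) subgraph. *)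
Definition contains (H G : sgraph) : Prop :=
  exists f : H -> G, injective f /\ forall x y : H, adj x y -> adj (f x) (f y).

Definition degree (G : sgraph) (v : G) : nat := #|[set w | adj v w]|.

Section Multipartite.
Variable a : seq nat.

Definition multipartite_vertex : finType :=
  {i : 'I_(size a) & 'I_(nth 0 a i)}.

Definition multipartite_adj (x y : multipartite_vertex) : bool :=
  tag x != tag y.

Lemma multipartite_sym : symmetric multipartite_adj.
Proof. by move=> x y; rewrite /multipartite_adj eq_sym. Qed.

Lemma multipartite_irr : irreflexive multipartite_adj.
Proof. by move=> x; rewrite /multipartite_adj eqxx. Qed.

(* K_p(a_1, ..., a_p) for a = [:: a_1; ...; a_p]. *)
Definition complete_multipartite : sgraph :=
  SGraph multipartite_sym multipartite_irr.
End Multipartite.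

Definition star (m : nat) : sgraph := complete_multipartite [:: 1; m].

Section Book.
Variables k n : nat.

Definition book_adj (x y : 'I_n) : bool := (x != y) && ((x < k) || (y < k)).

Lemma book_sym : symmetric book_adj.
Proof. by move=> x y; rewrite /book_adj eq_sym orbC. Qed.

Lemma book_irr : irreflexive book_adj.
Proof. by move=> x; rewrite /book_adj eqxx. Qed.

(* B_{k,n}: the vertices 0, ..., k-1 form the common K_k. *)
Definition book : sgraph := SGraph book_sym book_irr.
End Book.

Definition ramsey_prop (H1 H2 : sgraph) (N : nat) : Prop :=
  forall G : sgraph, #|G| = N -> contains H1 G \/ contains H2 (compl G).

Lemma contains_clique (H G : sgraph) (C : {set G}) :
  #|H| <= #|C| -> {in C &, forall x y, x != y -> adj x y} -> contains H G.
Proof.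
move=> leHC Ccl; pose f (x : H) : G := enum_val (widen_ord leHC (enum_rank x)).
have finj : injective f.
  move=> x y /enum_val_inj /(congr1 val) /= /val_inj; exact: enum_rank_inj.
exists f; split=> // x y xy; apply: Ccl; try exact: enum_valP.
by apply/eqP => /finj exy; rewrite exy adj_irr in xy.
Qed.

Lemma ramsey_sets (G : sgraph) (p q : nat) (A : {set G}) :
  2 ^ (p + q) <= #|A| ->
  (exists C : {set G}, [/\ C \subset A, #|C| = p &
     {in C &, forall x y, x != y -> adj x y}]) \/
  (exists C : {set G}, [/\ C \subset A, #|C| = q &
     {in C &, forall x y, x != y -> ~~ adj x y}]).
Proof.
elim: p q A => [|p IHp] q.
  move=> A _; left; exists set0.
  by split; [exact: sub0set | exact: cards0 | move=> x y; rewrite inE].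
elim: q => [|q IHq] A hA.
  right; exists set0.
  by split; [exact: sub0set | exact: cards0 | move=> x y; rewrite inE].
have /card_gt0P [x xA] : 0 < #|A| by apply: leq_trans hA; rewrite expn_gt0.
pose X := A :&: [set y | adj x y]; pose Y := (A :\ x) :\: [set y | adj x y].
have XY : #|A| = (#|X| + #|Y|).+1.
  rewrite (cardsD1 x A) xA -(cardsID [set y | adj x y] (A :\ x)) add1n.
  congr (_ + _).+1; apply: eq_card => y; rewrite !inE.
  by case: (eqVneq y x) => [->|]; rewrite ?adj_irr ?andbF.
have [hX|hY] : 2 ^ (p + q.+1) <= #|X| \/ 2 ^ (p.+1 + q) <= #|Y|.
  have := hA; rewrite XY addSn expnS addSnnS; lia.
- have [[C [CX cC Ccl]]|[C [CX cC Cin]]] := IHp q.+1 X hX.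
  + left; exists (x |: C); split.
    * by rewrite subUset sub1set xA (subset_trans CX) // subsetIl.
    * rewrite cardsU1 cC; suff -> : x \notin C by [].
      by apply/negP=> /(subsetP CX); rewrite !inE adj_irr andbF.
    * have xC z : z \in C -> adj x z.
        by move/(subsetP CX); rewrite !inE => /andP[].
      move=> y z; rewrite !inE => /predU1P[->|yC] /predU1P[->|zC].
      - by rewrite eqxx.
      - by move=> _; exact: xC.
      - by move=> _; rewrite adj_sym; exact: xC.
      - exact: Ccl.
  + by right; exists C; split=> //; rewrite (subset_trans CX) // subsetIl.
- have YA : Y \subset A by apply: subset_trans (subsetDl _ _) (subsetDl _ _).
  have [[C [CY cC Ccl]]|[C [CY cC Cin]]] := IHq Y hY.
  + by left; exists C; split=> //; rewrite (subset_trans CY).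
  + right; exists (x |: C); split.
    * by rewrite subUset sub1set xA (subset_trans CY).
    * rewrite cardsU1 cC; suff -> : x \notin C by [].
      by apply/negP=> /(subsetP CY); rewrite !inE eqxx !andbF.
    * have xC z : z \in C -> ~~ adj x z.
        by move/(subsetP CY); rewrite !inE => /andP[].
      move=> y z; rewrite !inE => /predU1P[->|yC] /predU1P[->|zC].
      - by rewrite eqxx.
      - by move=> _; exact: xC.
      - by move=> _; rewrite adj_sym; exact: xC.
      - exact: Cin.
Qed.

Lemma ramsey_exists (H1 H2 : sgraph) :
  exists N, `[< 0 < N /\ ramsey_prop H1 H2 N >].
Proof.
exists (2 ^ (#|H1| + #|H2|)); apply/asboolP; split; first by rewrite expn_gt0.
move=> G cG.
have := @ramsey_sets G #|H1| #|H2| setT; rewrite cardsT cG leqnn.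
case=> // -[C [_ cC hC]]; [left|right].
  by apply: (contains_clique _ hC); rewrite cC.
apply: (@contains_clique H2 (compl G) C); first by rewrite cC.
by move=> x y xC yC xy /=; rewrite xy (hC x y).
Qed.

Definition ramsey_number (H1 H2 : sgraph) : nat := ex_minn (ramsey_exists H1 H2).

Lemma ramsey_numberP (H1 H2 : sgraph) (r : nat) :
  ramsey_number H1 H2 = r <->
  [/\ 0 < r, ramsey_prop H1 H2 r &
      forall N, 0 < N -> ramsey_prop H1 H2 N -> r <= N].
Proof.
rewrite /ramsey_number; case: ex_minnP => m /asboolP[m0 hm] mmin; split.
  by move=> <-; split=> // N N0 hN; apply: mmin; apply/asboolP.
case=> r0 hr rmin; apply/eqP; rewrite eqn_leq rmin // andbT.
by apply: mmin; apply/asboolP.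
Qed.

Definition dk_prop (k n : nat) (H : sgraph) (d : nat) : Prop :=
  exists G : sgraph, [/\ #|G| = n + d - 1, ~ contains H G &
    #|[set v : G | degree v < d]| <= k - 1].

(* d_k(n, H).  The value 0 is a default for when no maximum exists; see dkP. *)
Definition dk (k n : nat) (H : sgraph) : nat :=
  classical_sets.xget 0
    (fun d => dk_prop k n H d /\ forall e, dk_prop k n H e -> e <= d).

Lemma greedy_clique (G : sgraph) (n h : nat) (A : {set G}) :
  {in A, forall v : G, #|[set w | ~~ adj v w]| <= n} -> h * n.+1 <= #|A| ->
  exists C : {set G}, [/\ C \subset A, #|C| = h &
    {in C &, forall x y, x != y -> adj x y}].
Proof.
elim: h A => [|h IH] A hA cA.
  exists set0.
  by split; [exact: sub0set | exact: cards0 | move=> x y; rewrite inE].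
have /card_gt0P [x xA] : 0 < #|A| by apply: leq_trans cA; rewrite mulSn.
pose X := A :\: [set w | ~~ adj x w].
have XA : X \subset A by exact: subsetDl.
have [||C [CX cC Ccl]] := IH X.
- by move=> v /(subsetP XA); exact: hA.
- have := cardsID [set w | ~~ adj x w] A; rewrite -/X.
  have : #|A :&: [set w | ~~ adj x w]| <= n.
    by apply: leq_trans (hA x xA); apply: subset_leq_card; exact: subsetIr.
  move: cA; rewrite mulSn; lia.
exists (x |: C); split.
- by rewrite subUset sub1set xA (subset_trans CX).
- rewrite cardsU1 cC; suff -> : x \notin C by [].
  by apply/negP=> /(subsetP CX); rewrite !inE adj_irr.
- have xC z : z \in C -> adj x z.
    by move/(subsetP CX); rewrite !inE negbK => /andP[].
  move=> y z; rewrite !inE => /predU1P[->|yC] /predU1P[->|zC].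
  + by rewrite eqxx.
  + by move=> _; exact: xC.
  + by move=> _; rewrite adj_sym; exact: xC.
  + exact: Ccl.
Qed.

Lemma dk_bounded (k n : nat) (H : sgraph) (d : nat) :
  0 < n -> dk_prop k n H d -> d <= #|H| * n + k.
Proof.
move=> n0 [G [cG nH low]]; rewrite leqNgt; apply/negP => hd; apply: nH.
pose A := [set v : G | d <= degree v].
have cA : #|G| - (k - 1) <= #|A|.
  have := cardsC A; suff -> : ~: A = [set v : G | degree v < d] by lia.
  by apply/setP => v; rewrite !inE ltnNge.
have [||C [_ cC Ccl]] := @greedy_clique G n.-1 #|H| A.
- move=> v; rewrite inE /degree => dv.
  have := cardsC [set w | adj v w].
  have -> : ~: [set w | adj v w] = [set w | ~~ adj v w].
    by apply/setP => w; rewrite !inE.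
  rewrite cG; lia.
- rewrite prednK //; apply: leq_trans cA; rewrite cG; lia.
by apply: (contains_clique _ Ccl); rewrite cC.
Qed.

(* The maximum exists as soon as n > 0 and H has an edge. *)
Lemma dkP (k n : nat) (H : sgraph) (x y : H) (d : nat) :
  0 < n -> adj x y ->
  dk k n H = d <->
  dk_prop k n H d /\ forall e, dk_prop k n H e -> e <= d.
Proof.
move=> n0 xy.
have ex0 : exists e, `[< dk_prop k n H e >].
  have s : symmetric (fun _ _ : 'I_n.-1 => false) by [].
  have i : irreflexive (fun _ _ : 'I_n.-1 => false) by [].
  exists 0; apply/asboolP; exists (SGraph s i); split.
  - by rewrite card_ord; lia.
  - by case=> f [_ /(_ x y xy)].
  - by rewrite (_ : [set _ | _] = set0) ?cards0 //; apply/setP => v; rewrite !inE.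
have bd e : `[< dk_prop k n H e >] -> e <= #|H| * n + k.
  by move/asboolP; exact: dk_bounded.
have [m /asboolP hm mmax] := ex_maxnP ex0 bd.
have dkm : dk k n H = m.
  apply: classical_sets.xget_unique.
    by split=> // e he; apply: mmax; apply/asboolP.
  move=> e [he emax]; apply/eqP; rewrite eqn_leq emax // andbT.
  by apply: mmax; apply/asboolP.
rewrite dkm; split.
  by move=> <-; split=> // e he; apply: mmax; apply/asboolP.
case=> hd dmax; apply/eqP; rewrite eqn_leq dmax //.
by apply: mmax; apply/asboolP.
Qed.

(* Main.v *)
Require Import Defs.
From mathcomp Require Import all_boot.
From mathcomp Require Import zify.

Set Implicit Arguments.
Unset Strict Implicit.
Unset Printing Implicit Defensive.

(** Since the maximum degree of a [K_{1,a_2}]-free graph is less than [a_2],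
the number [d := d_k(n, K_{1,a_2})] is less than [a_2].  So it suffices to
find a graph on [(p-1)(n-1) + d + 1] vertices which contains no
[K_p(1,a_2,...,a_p)] and whose complement contains no [B_{k,n}].  We take a
join of [p-1] graphs, each a disjoint union of cliques of some size [c] and
at most one smaller clique.  For [p >= 3] these have [n+d-1], [n], [n-1], ...,
[n-1] vertices with [c = a_2, 2, 1, ..., 1]; for [p = 2] (hence [k >= 3])
there is a single one, with [n+d] vertices and [c = a_2].

A book in the complement lies in one factor, and at least [k-1] of its [k]
central vertices are in full cliques, which contain no other vertex of the
book; so that factor has at least [n + (k-1)(c-1)] vertices, which is false.
In a copy of [K_p(1,a_2,...,a_p)], each factor with [c = 1] meets at most one
part, so at least two parts ([p = 2]) or three ([p >= 3]) avoid those factors;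
the bound [c-1] on the degrees in the other factors excludes this. *)

(** * Blocks of [c] consecutive vertices among [m] *)

Lemma card_block_le (m c q : nat) :
  0 < c -> #|[set v : 'I_m | v %/ c == q]| <= c.
Proof.
move=> c0; rewrite -[leqRHS]card_ord.
rewrite -(@card_in_imset _ _ (fun v : 'I_m => Ordinal (ltn_pmod v c0))).
  exact: max_card.
move=> u v; rewrite !inE => /eqP uq /eqP vq [uv]; apply: val_inj.
by rewrite /= (divn_eq u c) (divn_eq v c) uq vq uv.
Qed.

Lemma card_block_full (m c q : nat) :
  q < m %/ c -> c <= #|[set v : 'I_m | v %/ c == q]|.
Proof.
move=> qm; have hlt (i : 'I_c) : q * c + i < m.
  apply: leq_trans (leq_divM m c).
  by rewrite -addnS (leq_trans _ (leq_mul qm (leqnn c))) // mulSn addnC leq_add2r.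
have hinj : injective (fun i : 'I_c => Ordinal (hlt i)).
  by move=> i j [] /addnI /val_inj.
rewrite -[leqLHS]card_ord -(card_imset _ hinj); apply: subset_leq_card.
apply/subsetP => _ /imsetP[i _ ->]; rewrite inE /=.
by rewrite divnMDl ?divn_small ?addn0 // (leq_ltn_trans _ (ltn_ord i)).
Qed.

(** Counting block by block: a full block holding one of the first [k] images holds no other image,
    so [c - 1] of its vertices are missed. These [k] blocks are distinct, and at most one of them is
    incomplete. *)
Lemma isolated_blocks_bound (m c k n : nat) (g : 'I_n -> 'I_m) :
  0 < c -> k <= n -> injective g ->
  (forall x y : 'I_n, x < k -> x != y -> g x %/ c != g y %/ c) ->
  n + (k - 1) * (c - 1) <= m.
Proof.
move=> c0 kn ginj giso.
pose b (v : 'I_m) : 'I_(m %/ c).+1 := inord (v %/ c).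
have bE v : b v = v %/ c :> nat.
  by rewrite inordK // ltnS leq_div2r // ltnW.
pose S := [set g x | x : 'I_n].
(* Here [ord_max] is the index [m %/ c] of the only incomplete (possibly empty) block. *)
pose J := [set b (g (widen_ord kn t)) | t : 'I_k] :\ ord_max.
have cJ : k - 1 <= #|J|.
  have := cardsD1 ord_max [set b (g (widen_ord kn t)) | t : 'I_k].
  rewrite card_imset ?card_ord -/J; first by case: (_ \in _); lia.
  move=> t u e; apply/eqP; apply/negPn/negP => tu.
  have := giso (widen_ord kn t) (widen_ord kn u) (ltn_ord t).
  by rewrite -!bE e eqxx => /(_ tu).
have blockE (q : 'I_(m %/ c).+1) :
    #|[set v | b v == q]| = #|[set v : 'I_m | v %/ c == q]|.
  by apply: eq_card => v; rewrite !inE -val_eqE /= bE.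
have hq (q : 'I_(m %/ c).+1) :
    #|[set v in S | b v == q]| + (q \in J) * (c - 1) <= #|[set v | b v == q]|.
  case: (boolP (q \in J)) => [|_]; last first.
    rewrite mul0n addn0; apply: subset_leq_card.
    by apply/subsetP => v; rewrite !inE => /andP[].
  rewrite !inE => /andP[qmax /imsetP[t _ qt]].
  have qfull : q < m %/ c.
    by rewrite ltn_neqAle -ltnS ltn_ord andbT.
  have := card_block_full qfull; rewrite -blockE.
  suff : #|[set v in S | b v == q]| <= 1 by lia.
  rewrite -(cards1 (g (widen_ord kn t))); apply: subset_leq_card.
  apply/subsetP => v; rewrite !inE => /andP[/imsetP[x _ ->]] /eqP.
  rewrite qt => /(congr1 val); rewrite /= !bE => e.
  apply/eqP; congr (g _); apply/eqP; rewrite eq_sym.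
  apply/negPn/negP => tx.
  by have := giso _ _ (ltn_ord t : widen_ord kn t < k) tx; rewrite e eqxx.
have part (A : {set 'I_m}) : #|A| = \sum_q #|[set v in A | b v == q]|.
  rewrite -sum1_card (partition_big b xpredT) //=; apply: eq_bigr => q _.
  by rewrite -sum1_card; apply: eq_bigl => v; rewrite inE.
have mE : m = \sum_q #|[set v | b v == q]|.
  rewrite -{1}(card_ord m) -cardsT (part setT); apply: eq_bigr => q _.
  by apply: eq_card => v; rewrite !inE.
have nE : n = #|S| by rewrite card_imset ?card_ord.
have := @leq_sum _ (index_enum _) xpredT _ _ (fun q _ => hq q); rewrite -mE.
apply: leq_trans; rewrite big_split /= -(part S) -nE leq_add2l -big_distrl.
by rewrite /= -big_mkcond /= sum1_card leq_mul2r cJ orbT.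
Qed.

(** * Joins of disjoint unions of cliques *)

Section CliqueJoin.
Variables (q : nat) (m c : nat -> nat).

(* The join of [q] factors; in the factor [j], the blocks of [c j] consecutive
vertices out of [m j] are the cliques, the last one possibly incomplete. *)
Definition clique_join_vertex : finType := {j : 'I_q & 'I_(m j)}.

Definition clique_join_adj (x y : clique_join_vertex) : bool :=
  (tag x != tag y) ||
  ((x != y) && (tagged x %/ c (tag x) == tagged y %/ c (tag y))).

Lemma clique_join_sym : symmetric clique_join_adj.
Proof.
move=> x y; rewrite /clique_join_adj [x == y]eq_sym [tag x == _]eq_sym.
by rewrite [_ %/ _ == _]eq_sym.
Qed.

Lemma clique_join_irr : irreflexive clique_join_adj.
Proof. by move=> x; rewrite /clique_join_adj !eqxx. Qed.

Definition clique_join : sgraph := SGraph clique_join_sym clique_join_irr.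

Lemma card_clique_join : #|clique_join| = \sum_(j < q) m j.
Proof.
rewrite card_tagged sumnE big_map big_enum /=.
by apply: eq_bigr => j _; rewrite card_ord.
Qed.

Lemma clique_join_vertex_inj (x y : clique_join) :
  tag x = tag y -> tagged x = tagged y :> nat -> x = y.
Proof.
by case: x y => [j x] [j' y] /= e; case: _ / e y => y /= /val_inj ->.
Qed.

Lemma clique_join_book_free (k n : nat) :
  1 < k -> k < n -> (forall j : nat, j < q -> 0 < c j) ->
  (forall j : nat, j < q -> m j < n + (k - 1) * (c j - 1)) ->
  ~ contains (book k n) (compl clique_join).
Proof.
move=> k1 kn c0 mn [g [ginj gadj]].
have n0 : 0 < n by lia.
(* The central vertex [o] is adjacent to all others, and no edge of the complement joins two
   factors; so the book stays in one factor. *)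
pose o : 'I_n := Ordinal n0.
have gtag x : tag (g x) = tag (g o).
  case: (eqVneq x o) => [->//|xo].
  have : @adj (book k n) o x by rewrite /= /book_adj eq_sym xo /= (ltnW k1).
  by move/gadj; rewrite /= negb_or negbK => /and3P[_ /eqP].
have gm x : tagged (g x) < m (tag (g o)).
  by rewrite -(gtag x) ltn_ord.
have /= := mn _ (ltn_ord (tag (g o))); rewrite ltnNge => /negP; apply.
apply: (@isolated_blocks_bound _ _ _ _ (fun x => Ordinal (gm x))).
- by apply: c0; exact: ltn_ord.
- exact: ltnW.
- move=> x y [e]; apply: ginj; apply: clique_join_vertex_inj => //.
  by rewrite !gtag.
- move=> x y xk xy; have : @adj (book k n) x y by rewrite /= /book_adj xy xk.
  move/gadj; rewrite /= negb_or negb_and => /and3P[-> _] /=.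
  have ctag z : c (tag (g z)) = c (tag (g o)) by rewrite gtag.
  by rewrite !ctag.
Qed.

Section Multipartite.
Variables (a : seq nat) (f : complete_multipartite a -> clique_join).
Hypothesis c_gt0 : forall j : nat, j < q -> 0 < c j.
Hypothesis f_inj : injective f.
Hypothesis f_adj :
  forall x y : complete_multipartite a, adj x y -> adj (f x) (f y).

(** These vertices are all adjacent to [x], so within its factor they share the clique of [f x], and
    [f x] itself takes one place there. *)
Lemma card_other_parts (x : complete_multipartite a) :
  #|[set y | (tag y != tag x) && (tag (f y) == tag (f x))]| < c (tag (f x)).
Proof.
set Y := [set y | _]; have xY : x \notin Y by rewrite inE eqxx.
have -> : #|Y|.+1 = #|x |: Y| by rewrite cardsU1 xY.
have hlt y : tag (f y) == tag (f x) -> tagged (f y) < m (tag (f x)).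
  by move/eqP <-; exact: ltn_ord.
(* This reads [f y] inside the factor of [f x]; the default is never taken on [x |: Y]. *)
pose h y : 'I_(m (tag (f x))) := insubd (tagged (f x)) (tagged (f y) : nat).
have sameF y : y \in x |: Y -> tag (f y) == tag (f x).
  by rewrite !inE => /predU1P[->|/andP[]].
have hE y : y \in x |: Y -> h y = tagged (f y) :> nat.
  by move/sameF/hlt => lt; rewrite val_insubd lt.
rewrite -(@card_in_imset _ _ h); last first.
  move=> y z yY zY e; apply: f_inj; apply: clique_join_vertex_inj.
    by rewrite (eqP (sameF _ yY)) (eqP (sameF _ zY)).
  by rewrite -!hE // e.
apply: leq_trans (card_block_le _ (tagged (f x) %/ c (tag (f x))) (c_gt0 (ltn_ord _))).
apply: subset_leq_card; apply/subsetP => _ /imsetP[y yY ->].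
rewrite inE hE //; move: yY; rewrite !inE => /predU1P[->//|/andP[yx fyx]].
have : adj y x by exact: yx.
have cyx : c (tag (f y)) = c (tag (f x)) by rewrite (eqP fyx).
by move/f_adj; rewrite /= /clique_join_adj fyx cyx /= => /andP[].
Qed.

Lemma card_two_parts (x : complete_multipartite a) (t u : 'I_(size a)) :
  tag x != t -> tag x != u -> t != u ->
  #|[set y | (tag y == t) && (tag (f y) == tag (f x))]| +
  #|[set y | (tag y == u) && (tag (f y) == tag (f x))]| < c (tag (f x)).
Proof.
move=> xt xu tu; apply: leq_ltn_trans (card_other_parts x).
rewrite -cardsUI [X in _ + X](_ : _ = 0) ?addn0.
  apply: subset_leq_card; apply/subsetP => y; rewrite !inE.
  by case/orP=> /andP[/eqP-> ->]; rewrite eq_sym ?xt ?xu.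
apply/eqP; rewrite cards_eq0; apply/eqP/setP => y; rewrite !inE.
by apply/negP => /andP[/andP[/eqP-> _] /andP[/eqP e _]]; rewrite e eqxx in tu.
Qed.

Lemma card_one_part (x : complete_multipartite a) (t : 'I_(size a)) :
  tag x != t ->
  #|[set y | (tag y == t) && (tag (f y) == tag (f x))]| < c (tag (f x)).
Proof.
move=> xt; apply: leq_ltn_trans (card_other_parts x).
apply: subset_leq_card; apply/subsetP => y; rewrite !inE.
by case/andP=> /eqP-> ->; rewrite eq_sym xt.
Qed.

(** By [card_other_parts], a factor with [c j = 1] meets at most one part, so choosing such a factor
    for each bad part is injective. *)
Lemma parts_avoiding_independent :
  exists T : {set 'I_(size a)},
    size a - #|[set j : 'I_q | c j == 1]| <= #|T| /\
    forall x : complete_multipartite a, tag x \in T -> c (tag (f x)) != 1.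
Proof.
pose I := [set j : 'I_q | c j == 1].
pose Bad := [set t : 'I_(size a) |
  [exists x : complete_multipartite a, (tag x == t) && (tag (f x) \in I)]].
exists (~: Bad); split; last first.
  by move=> x; rewrite !inE => /existsPn /(_ x); rewrite eqxx /= inE.
suff : #|Bad| <= #|I|.
  have := cardsC Bad; rewrite card_ord -/I; move: #|~: Bad| #|Bad| #|I|; lia.
pose r (t : 'I_(size a)) :=
  omap (fun x : complete_multipartite a => tag (f x))
    [pick x : complete_multipartite a | (tag x == t) && (tag (f x) \in I)].
have rP t : t \in Bad -> exists x : complete_multipartite a,
    [/\ r t = Some (tag (f x)), tag x = t & tag (f x) \in I].
  rewrite inE /r => /existsP[x hx]; case: pickP => [y /andP[/eqP ty yI]|/(_ x)].
    by exists y.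
  by rewrite hx.
rewrite -(@card_in_imset _ _ r Bad); last first.
  move=> t u /rP[x [-> <- xI]] /rP[y [-> <- yI]] [e].
  apply/eqP/negPn/negP => xy; move: (card_other_parts x).
  move: xI; rewrite inE => /eqP->; rewrite ltnS leqn0 cards_eq0 => /eqP/setP/(_ y).
  by rewrite !inE eq_sym xy e eqxx.
rewrite -(card_imset I (@Some_inj _)); apply: subset_leq_card.
by apply/subsetP => _ /imsetP[t /rP[x [-> _ xI]] ->]; exact: imset_f.
Qed.

End Multipartite.
End CliqueJoin.

(** * Part sizes, and stars in graphs of large degree *)

Lemma card_part (a : seq nat) (t : 'I_(size a)) :
  nth 0 a t <= #|[set x : complete_multipartite a | tag x == t]|.
Proof.
have inj : injective (fun i : 'I_(nth 0 a t) =>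
    (Tagged (fun t : 'I_(size a) => 'I_(nth 0 a t)) i : complete_multipartite a)).
  by move=> i j /eqP; rewrite eq_Tagged => /eqP.
rewrite -[leqLHS]card_ord -(card_imset _ inj); apply: subset_leq_card.
by apply/subsetP => _ /imsetP[i _ ->]; rewrite inE.
Qed.

Lemma star_contained (b : nat) (G : sgraph) (v : G) :
  b <= degree v -> contains (star b) G.
Proof.
move=> bv; pose nb := enum [set w | adj v w].
have snb : size nb = degree v by rewrite -cardE.
pose f (x : star b) := if tag x == 0 :> nat then v else nth v nb (tagged x).
have leaf (x : star b) : tag x != 0 :> nat -> tagged x < size nb.
  rewrite snb; case: x => -[[|[|i]] hi] y //= _; exact: leq_trans (ltn_ord y) bv.
have fv (x : star b) : tag x = 0 :> nat -> f x = v.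
  by rewrite /f => /eqP ->.
have adjf (x : star b) : tag x != 0 :> nat -> adj v (f x).
  move=> x0; rewrite /f (negbTE x0).
  by have := mem_nth v (leaf x x0); rewrite mem_enum inE.
have tag1 (x : star b) : tag x != 0 :> nat -> tag x = 1 :> nat.
  by have := ltn_ord (tag x); rewrite /=; lia.
exists f; split=> [x y|x y].
  case: (eqVneq (tag x : nat) 0) => x0; case: (eqVneq (tag y : nat) 0) => y0.
  - case: x x0 y y0 => i x /= i0 [j y] /= j0 _.
    have ij : i = j by apply: val_inj; rewrite /= i0 j0.
    case: _ / ij y j0 => y _; congr existT; apply: val_inj.
    by case: x y => [x +] [y +] /=; rewrite i0 /=; lia.
  - by have := adjf y y0; rewrite (fv x) // => + e; rewrite -e adj_irr.
  - by have := adjf x x0; rewrite (fv y) // => + e; rewrite e adj_irr.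
  - have tt : tag x = tag y by apply: val_inj; exact: etrans (tag1 x x0) (esym (tag1 y y0)).
    rewrite /f (negbTE x0) (negbTE y0) => /eqP.
    rewrite nth_uniq ?enum_uniq ?leaf // => /eqP.
    clear x0 y0; case: x y tt => i x [j y] /= ij.
    by case: _ / ij y => y /val_inj ->.
rewrite /= /multipartite_adj -val_eqE /= => xy.
case: (eqVneq (tag x : nat) 0) => x0; case: (eqVneq (tag y : nat) 0) => y0.
- by rewrite x0 y0 in xy.
- by rewrite (fv x) // adjf.
- by rewrite adj_sym (fv y) // adjf.
- by move: xy; rewrite (tag1 x x0) (tag1 y y0).
Qed.

(** As [n + d - 1 > k - 1], some vertex has degree at least [d]; if [b <= d], it would be the centre
    of a star. *)
Lemma dk_star_lt (k n b : nat) : 0 < b -> k < n -> dk k n (star b) < b.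
Proof.
move=> b0 kn; pose x : star b := @Tagged _ (@Ordinal 2 0 isT)
  (fun i : 'I_2 => 'I_(nth 0 [:: 1; b] i)) (@Ordinal 1 0 isT).
pose y : star b := @Tagged _ (@Ordinal 2 1 isT)
  (fun i : 'I_2 => 'I_(nth 0 [:: 1; b] i)) (Ordinal b0).
have n0 : 0 < n by lia.
have [] := (@dkP k n (star b) x y _ n0 isT).1 erefl.
move: (dk _ _ _) => d [G [cG nstar low]] _; rewrite ltnNge; apply/negP => bd.
apply: nstar; have /card_gt0P[v] : 0 < #|~: [set v : G | degree v < d]|.
  have := cardsC [set v : G | degree v < d]; rewrite cG; lia.
by rewrite !inE -leqNgt => dv; apply: (@star_contained _ _ v); exact: leq_trans dv.
Qed.

Theorem mainTheorem3 (k p n : nat) (a : nat -> nat)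
  (hk : 2 <= k) (hp : 2 <= p) (hkp : (k, p) <> (2, 2))
  (ha2 : 2 <= a 2)
  (ha : forall i j : nat, 2 <= i -> i <= j -> j <= p -> a i <= a j)
  (hn : k.+1 <= n) :
  ramsey_number (complete_multipartite (1 :: [seq a i | i <- index_iota 2 p.+1]))
                (book k n)
  <> (p - 1) * (n - 1) + dk k n (star (a 2)) + 1.
Proof.
have dlt : dk k n (star (a 2)) < a 2 by apply: dk_star_lt; lia.
move: (dk _ _ _) dlt => d dlt.
set b := 1 :: _ => /ramsey_numberP[_ hr _].
have sb : size b = p by rewrite /= size_map size_iota; lia.
have b0 t : t < p -> 1 <= nth 0 b t.
  case: t => // t tp; rewrite /= (nth_map 0) ?size_iota ?nth_iota; try lia.
  by have := ha 2 (2 + t); lia.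
have b1 t : 0 < t < p -> a 2 <= nth 0 b t.
  case: t => // t tp; rewrite /= (nth_map 0) ?size_iota ?nth_iota; try lia.
  by have := ha 2 (2 + t); lia.
(* In both cases the sizes add up to [(p - 1) * (n - 1) + d + 1]. *)
pose m j := if p == 2 then n + d else
  if j == 0 then n + d - 1 else if j == 1 then n else n - 1.
pose c j := if j == 0 then a 2 else if j == 1 then 2 else 1.
have c0 j : j < p.-1 -> 0 < c j by rewrite /c; case: j => [|[|j]] /=; lia.
have k3 : p = 2 -> 2 < k.
  move=> p2; have : k <> 2 by move=> k2; apply: hkp; rewrite k2 p2.
  lia.
case: (hr (clique_join p.-1 m c)).
- rewrite card_clique_join /m; case: eqP => [p2|/eqP p2].
    by rewrite p2 big_ord_recl big_ord0 /=; lia.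
  have [p' pE] : exists p', p = p'.+3 by exists (p - 3); lia.
  rewrite pE !big_ord_recl /= sum_nat_const card_ord; lia.
- case=> f [finj fadj].
  have [T [cT hT]] := parts_avoiding_independent c0 finj fadj.
  pose w (t : 'I_(size b)) (i : nat) :=
    #|[set y : complete_multipartite b | (tag y == t) && (tag (f y) == i :> nat)]|.
  have wsum t : t \in T -> nth 0 b t <= w t 0 + w t 1.
    move=> tT; apply: leq_trans (card_part t) _.
    apply: leq_trans (leq_card_setU _ _); apply: subset_leq_card.
    apply/subsetP => y; rewrite !inE => /eqP yt; rewrite yt eqxx /=.
    have := hT y; rewrite yt => /(_ tT); rewrite /c.
    by case: (val (tag (f y))) => [|[|i]].
  have w2 t u i : t != u -> 0 < w t i -> w u i < c i.
    move=> tu /card_gt0P[x]; rewrite inE => /andP[/eqP xt /eqP xi].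
    have := @card_one_part _ _ _ _ _ c0 finj fadj x u.
    rewrite /w xt -xi; exact.
  have w3 t u v i : t != u -> t != v -> u != v -> 0 < w t i ->
      w u i + w v i < c i.
    move=> tu tv uv /card_gt0P[x]; rewrite inE => /andP[/eqP xt /eqP xi].
    have := @card_two_parts _ _ _ _ _ c0 finj fadj x u v.
    rewrite /w xt -xi; exact.
  have ltp (t : 'I_(size b)) : t < p := leq_trans (ltn_ord t) (eq_leq sb).
  have bpos (t : 'I_(size b)) : 0 < nth 0 b t by exact: b0.
  have blarge (t u : 'I_(size b)) : t != u ->
      (a 2 <= nth 0 b t) || (a 2 <= nth 0 b u).
    rewrite -val_eqE => tu.
    case: (posnP t) => [t0|t0]; last by rewrite b1 // t0 ltp.
    by rewrite orbC b1 // ltp andbT lt0n -t0 eq_sym.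
  have {}cT : p - #|[set j : 'I_p.-1 | c j == 1]| <= #|T| by rewrite -[X in X - _]sb.
  (* For [p = 2] both parts lie in the factor 0, so each has fewer than [a 2] vertices, against
     [blarge]. *)
  case: (eqVneq p 2) => [p2|p2].
    have j0 (j : 'I_p.-1) : j = 0 :> nat by have := ltn_ord j; lia.
    have /card_gt1P[t [u [tT uT tu]]] : 1 < #|T|.
      apply: leq_trans cT; rewrite (_ : [set _ | _] = set0) ?cards0; first by lia.
      by apply/setP => j; rewrite !inE j0 /c /=; lia.
    have w1 v : w v 1 = 0.
      apply/eqP; rewrite cards_eq0; apply/eqP/setP => y; rewrite !inE.
      by rewrite j0 andbF.
    have := blarge _ _ tu; have := bpos t; have := bpos u.
    have := wsum _ tT; have := wsum _ uT; rewrite !w1 !addn0.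
    have := w2 _ _ 0 tu; have := w2 u t 0; rewrite eq_sym tu /c /=.
    lia.
  have /card_gt2P[t [u [v [[tT uT vT] [tu uv vt]]]]] : 2 < #|T|.
    apply: leq_trans cT.
    have p3 : 2 < p by lia.
    have q0 : 0 < p.-1 by lia.
    have q1 : 1 < p.-1 by lia.
    set I := [set j : 'I_p.-1 | c j == 1].
    suff : 1 < #|~: I|.
      by have := cardsC I; rewrite card_ord; move: #|~: I| #|I|; lia.
    apply/card_gt1P; exists (Ordinal q0), (Ordinal q1).
    by rewrite !inE /c /=; split => //; lia.
  (* Not all three parts meet factor 1. If two miss it, both lie in factor 0 with fewer than [a 2]
     vertices each, against [blarge]. Otherwise two parts have one vertex each in factor 1, and the
     third lies in factor 0. One of the two is large, so it has exactly [a 2 - 1] vertices in factor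
     0 and the other has none there. The other thus has size 1, so the third is large, which is too
     many for factor 0. *)
  have := blarge _ _ tu; have := blarge _ _ uv; have := blarge _ _ vt.
  have := bpos t; have := bpos u; have := bpos v.
  have := wsum _ tT; have := wsum _ uT; have := wsum _ vT.
  have ut : u != t by rewrite eq_sym.
  have vu : v != u by rewrite eq_sym.
  have tv : t != v by rewrite eq_sym.
  have := w3 t u v 0 tu tv uv; have := w3 u v t 0 uv ut vt.
  have := w3 v t u 0 vt vu tu.
  have := w3 t u v 1 tu tv uv; have := w3 u v t 1 uv ut vt.
  have := w3 v t u 1 vt vu tu; rewrite /c /=.
  lia.
- apply: clique_join_book_free => //.
  (* For [p = 2] the bound is [d < (k - 1) * (a 2 - 1)], true since [d <= a 2 - 1] and [k >= 3]. *)
  move=> j jp; rewrite /m /c; case: eqP => [p2|/eqP p2].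
    have -> : j = 0 by lia.
    rewrite eqxx; have := k3 p2; nia.
  by case: j jp => [|[|j]] /= _; nia.
Qed.
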